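(* Let $A$ be a real isotropic $d\times d$ dilation matrix, and let $G$, $m_0$ and $\mu$ be the associated functions defined in the context. Then the infinite product $$M(\xi):=\prod_{j=0}^{\infty}\mu\bigl((A^{-T})^j\xi\bigr)$$ converges absolutely and uniformly on any compact set. Moreover, the function $M$ is continuous on $\mathbb{R}^d$.
   Context: A real isotropic dilation matrix is a $d\times d$ matrix $A$ with integer entries, all of whose eigenvalues are greater than $1$ in absolute value, which is diagonalizable over $\mathbb{C}$ and all of whose eigenvalues have equal absolute value. Put $q:=|\det A|$ and $A^{-T}:=(A^T)^{-1}$. One can factor $A^{-T}=q^{-1/d}Q^{-1}UQ$ with $U$ real orthogonal and $Q$ real symmetric positive definite; fix such a $Q$ and write $Q^2=(q_{ij})_{1\le i,j\le d}$. Define $$G(\xi):=4\sum_{i} q_{ii}\sin^2\frac{\xi_i}{2}+2\sum_{i<j}q_{ij}\sin\xi_i\sin\xi_j .$$ Let $S(A^T):=\{s\in[0,1)^d: A^Ts\in\mathbb{Z}^d\}$ (this set has $q$ elements and contains $0$), and define the mask $$m_0(\xi):=\prod_{s\in S(A^T)\setminus\{0\}}\frac{G(\xi+2\pi s)}{G(2\pi s)}.$$ Define $$\mu(\xi):=\frac{q^{2/d}\,m_0(A^{-T}\xi)\,G(A^{-T}\xi)}{G(\xi)},$$ where at the points of $2\pi\mathbb{Z}^d$ (zeros of $G$) the value is understood as the limit. *)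

(* Defs.v *)
From HB Require Import structures.
From mathcomp Require Import all_boot all_order all_algebra.
From mathcomp Require Import all_classical all_reals all_analysis.
From mathcomp Require Import complex.
Set Implicit Arguments.
Unset Strict Implicit.
Unset Printing Implicit Defensive.
Import Order.TTheory GRing.Theory Num.Theory numFieldNormedType.Exports.
Local Open Scope classical_set_scope.
Local Open Scope ring_scope.

(* Points of R^d are column vectors; an integer matrix A is regarded as a real
   (resp. complex) matrix through [map_mx intr A]. *)

Definition isotropic_dilation (R : realType) (d : nat) (A : 'M[int]_d) : Prop :=
  let AC : 'M[R[i]]_d := map_mx intr A in
  [/\ forall l : R[i], eigenvalue AC l -> 1 < `|l|,
      diagonalizable AC
    & forall l l' : R[i], eigenvalue AC l -> eigenvalue AC l' -> `|l| = `|l'|].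

Definition posdefmx (R : realType) (d : nat) (Q : 'M[R]_d) : Prop :=
  Q^T = Q /\ forall x : 'cV[R]_d, x != 0 -> 0 < (x^T *m Q *m x) 0 0.

Definition orthogonalmx (R : realType) (d : nat) (U : 'M[R]_d) : Prop :=
  U^T *m U = 1%:M.

Definition realmx (R : realType) (d : nat) (A : 'M[int]_d) : 'M[R]_d :=
  map_mx intr A.

Definition absdet (R : realType) (d : nat) (A : 'M[int]_d) : R :=
  `|\det (realmx R A)|.

Definition invT (R : realType) (d : nat) (A : 'M[int]_d) : 'M[R]_d :=
  invmx (realmx R A)^T.

Definition factorization (R : realType) (d : nat) (A : 'M[int]_d)
    (Q : 'M[R]_d) : Prop :=
  posdefmx Q /\
  exists2 U : 'M[R]_d, orthogonalmx U &
    invT R A = absdet R A `^ (- d%:R^-1) *: (invmx Q *m U *m Q).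

Definition G (R : realType) (d : nat) (Q : 'M[R]_d) (xi : 'cV[R]_d) : R :=
  let q := Q *m Q in
  4 * (\sum_(i < d) q i i * sin (xi i 0 / 2) ^+ 2) +
  2 * (\sum_(i < d) \sum_(j < d | (i < j)%N)
         q i j * sin (xi i 0) * sin (xi j 0)).

Definition Zd (R : realType) (d : nat) : set 'cV[R]_d :=
  [set x : 'cV[R]_d | forall i, x i 0 \is a Num.int].

Definition SAT (R : realType) (d : nat) (A : 'M[int]_d) : set 'cV[R]_d :=
  [set s : 'cV[R]_d | (forall i, 0 <= s i 0 < 1) /\ Zd ((realmx R A)^T *m s)].

Definition m0 (R : realType) (d : nat) (A : 'M[int]_d) (Q : 'M[R]_d)
    (xi : 'cV[R]_d) : R :=
  \big[*%R/1]_(s \in SAT A `\ 0)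
    (G Q (xi + (2 * pi) *: s) / G Q ((2 * pi) *: s)).

Definition mu_formula (R : realType) (d : nat) (A : 'M[int]_d) (Q : 'M[R]_d)
    (xi : 'cV[R]_d) : R :=
  absdet R A `^ (2 / d%:R) * m0 A Q (invT R A *m xi) * G Q (invT R A *m xi)
  / G Q xi.

Definition mu (R : realType) (d : nat) (A : 'M[int]_d) (Q : 'M[R]_d)
    (xi : 'cV[R]_d) : R :=
  if xi \in [set (2 * pi) *: k | k in @Zd R d]
  then lim (mu_formula A Q x @[x --> xi^'])
  else mu_formula A Q xi.

(* Infinite products of functions f_0, f_1, ... *)

Definition infprod (R : realType) (T : Type) (f : nat -> T -> R) (x : T) : R :=
  lim ((fun n : nat => \prod_(0 <= j < n) f j x) @ \oo).

(* The product converges uniformly on K to [infprod f] in the strict sense used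
   for infinite products: up to finitely many factors, the limit has no zero. *)
Definition prod_unif_cvg (R : realType) (T : choiceType) (K : set T)
    (f : nat -> T -> R) : Prop :=
  {uniform K, (fun n x => \prod_(0 <= j < n) f j x) @ \oo --> infprod f} /\
  exists (m : nat) (g : T -> R), (forall x, K x -> g x != 0) /\
    {uniform K, (fun n x => \prod_(m <= j < n) f j x) @ \oo --> g}.

(* Absolute convergence of \prod_j f_j is convergence of
   \prod_j (1 + |f_j - 1|). *)
Definition prod_abs_unif_cvg (R : realType) (T : choiceType) (K : set T)
    (f : nat -> T -> R) : Prop :=
  prod_unif_cvg K f /\ prod_unif_cvg K (fun j x => 1 + `|f j x - 1|).

Definition mu_factor (R : realType) (d : nat) (A : 'M[int]_d) (Q : 'M[R]_d)
    (j : nat) (xi : 'cV[R]_d) : R :=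
  mu A Q ((invT R A) ^+ j *m xi).

Definition M (R : realType) (d : nat) (A : 'M[int]_d) (Q : 'M[R]_d) :
    'cV[R]_d -> R :=
  infprod (mu_factor A Q).

(* Main.v *)
Require Import Defs.
From HB Require Import structures.
From mathcomp Require Import all_boot all_order all_algebra.
From mathcomp Require Import all_classical all_reals all_analysis.
From mathcomp Require Import complex.
From mathcomp Require Import ring lra.
Import Order.TTheory GRing.Theory Num.Theory numFieldNormedType.Exports.
Local Open Scope classical_set_scope.
Local Open Scope ring_scope.

(** Write [B] for the inverse transpose of [A], [q = |det A|] and
    [rho = q^(-1/d)], so that [B = rho Q^-1 U Q] with [U] orthogonal, and let
    [N x = |Q x|^2], a quadratic form comparable with [|x|^2].

    The product converges because [mu x = 1 + O(|x|)] near the origin while the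
    orbit of [x] under [B] shrinks geometrically. The shrinking comes from
    [N (B x) = rho^2 N x] and [rho < 1] ([invTX_norm_le]); here [q > 1], since
    [q] is the product of the moduli of the eigenvalues of [A] ([absdet_gt1]).

    For the behaviour of [mu] at the origin, [G] agrees with [N] up to
    [O(|x|^4)] ([G_sqnorm_dist]), hence [q^(2/d) G (B x)] and [G x] both equal
    [N x] up to the same error, and their quotient is [1 + O(|x|^2)]; moreover
    [m0] is Lipschitz with [m0 0 = 1]. This gives [mu_formula_near].

    The value of [mu] at the other points of [2 pi Z^d], where its defining
    quotient is [0 / 0], is governed by the same estimate, because [mu] is
    [2 pi Z^d]-periodic: up to a constant, [m0 y * G y] is the product of
    [G (y + 2 pi s)] over all [s] in [S(A^T)], and adding an element [B k],
    [k] integral, permutes [S(A^T)] modulo [Z^d] ([prod_SAT_periodic]). Since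
    [G] is the sum of [N (sin x)] and of [4 q_ii sin^4 (x_i / 2)] over [i]
    ([G_sqnormE]), it vanishes exactly on [2 pi Z^d]; so [mu] is continuous
    everywhere and takes the value 1 on [2 pi Z^d].

    It remains to apply the Weierstrass test for infinite products
    ([prod_unif_cvg_summable]) with a geometric majorant of
    [|mu (B^j x) - 1|], both to the factors [f_j] and to [1 + |f_j - 1|].
    Locally uniform convergence of products of continuous factors gives the
    continuity of the limit ([infprod_continuous_at]). *)

(** * Infinite products *)

Lemma uniform_cvg_normP {R : realType} {T : choiceType} (K : set T)
    (F : nat -> T -> R) (g : T -> R) :
  (forall e, 0 < e ->
     \forall n \near \oo, forall x, K x -> `|g x - F n x| < e) <->
  {uniform K, F @ \oo --> g}.
Proof.
split=> [Fg P /uniform_nbhs[E [/= entE EP]]|Fg e e0].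
  move: entE; rewrite -entourage_ballE => -[e /= e0 eE].
  apply: filterS (Fg _ e0) => n Fn; apply: EP => x Kx.
  by apply: eE => /=; exact: Fn.
apply: (Fg [set h | forall x, K x -> `|g x - h x| < e]).
apply/uniform_nbhs; exists [set p | ball p.1 e p.2]; split=> //=.
by rewrite -entourage_ballE; exists e.
Qed.

(** With [S_n] the partial sums of [b] and [p_n] the partial products, the step
    is [|p_(n+1) - 1| <= |p_n - 1| + |p_n| b_n <= 2 S_n + 2 b_n]: the smallness
    of the sum keeps [|p_n| <= 2]. *)
Lemma norm_prodB1_le {R : realType} (a b : nat -> R) (m n : nat) :
  (forall j, 0 <= b j) -> (forall j, (m <= j)%N -> `|a j - 1| <= b j) ->
  \sum_(m <= j < n) b j <= 2^-1 ->
  `|\prod_(m <= j < n) a j - 1| <= 2 * \sum_(m <= j < n) b j.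
Proof.
move=> b0 ab; elim: n => [|n IH].
  by rewrite !big_geq// subrr normr0 mulr0.
have [mn|nm] := leqP m n; last by rewrite !big_geq// subrr normr0 mulr0.
rewrite !big_nat_recr//= => Sn.
have Sn' : \sum_(m <= j < n) b j <= 2^-1.
  by apply: le_trans Sn; rewrite lerDl.
move: (IH Sn') => {}IH; move: (ab n mn) => abn.
set p := \prod_(_ <= _ < _) _ in IH *; set S := \sum_(_ <= _ < _) _ in Sn Sn' IH *.
have -> : p * a n - 1 = (p - 1) + p * (a n - 1) by ring.
have p2 : `|p| <= 2.
  have -> : p = (p - 1) + 1 by ring.
  by rewrite (le_trans (ler_normD _ _))// normr1; lra.
rewrite [leRHS]mulrDr (le_trans (ler_normD _ _))// lerD// normrM.
by rewrite ler_pM.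
Qed.

(** Weierstrass test for infinite products. The tail [t n] of the series bounds
    every later block of factors, so that, past an index where the tail is
    below [1/6], the partial products form a uniformly Cauchy sequence which
    stays within distance [1/2] of 1; hence their limit has no zero. The first
    factors may vanish, but they are bounded, and multiplying by their product
    preserves uniform convergence. *)
Lemma prod_unif_cvg_summable {R : realType} {T : choiceType} (K : set T)
    (f : nat -> T -> R) (b : nat -> R) (m : nat) :
  (forall j, 0 <= b j) -> cvgn (series b) ->
  (forall j x, (m <= j)%N -> K x -> `|f j x - 1| <= b j) ->
  (forall j, exists B : R, forall x, K x -> `|f j x| <= B) ->
  prod_unif_cvg K f.
Proof.
move=> b0 cb fb bndf.
(* [t n] bounds all sums of consecutive terms of [b] starting at [n]. *)
pose t n := limn (series b) - series b n.
have sum_t n n' : \sum_(n <= j < n') b j <= t n.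
  have sb : nondecreasing_seq (series b).
    by apply/nondecreasing_seqP => k; rewrite !seriesEnat/= big_nat_recr//= lerDl.
  have [nn'|/ltnW n'n] := leqP n n'; last first.
    by rewrite big_geq// subr_ge0 nondecreasing_cvgn_le.
  rewrite lerBrDl; apply: le_trans (nondecreasing_cvgn_le sb cb n').
  by rewrite !seriesEnat/= -big_cat_nat.
have t_cvg0 : t @ \oo --> (0 : R).
  by rewrite -(subrr (limn (series b))); apply: cvgB => //; exact: cvg_cst.
have t_small (e : R) : 0 < e -> \forall n \near \oo, t n < e.
  by move=> e0; exact: (cvgr_lt 0).
(* Below 1/6, the bound [3 * t m'] on the distance from the limit to the empty
   product is less than 1. *)
have [m' [mm' tm']] : exists m', (m <= m')%N /\ t m' < 6^-1.
  have [k _ Hk] : \forall n \near \oo, t n < 6^-1 by apply: t_small; lra.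
  by exists (maxn m k); rewrite leq_maxl; split=> //; apply: Hk; exact: leq_maxr.
pose p n x := \prod_(m' <= j < n) f j x.
have p_step n n' x : K x -> (m' <= n)%N -> (n <= n')%N ->
    `|p n' x - p n x| <= 3 * t n.
  move=> Kx m'n nn'.
  have dist1 k k' : (m' <= k)%N -> t k < 2^-1 ->
      `|\prod_(k <= j < k') f j x - 1| <= 2 * t k.
    move=> m'k tk; apply: (@le_trans _ _ (2 * \sum_(k <= j < k') b j)).
      apply: norm_prodB1_le => // [j kj|]; last first.
        by rewrite (le_trans (sum_t _ _))// ltW.
      by apply: fb => //; apply: leq_trans kj; apply: leq_trans m'k.
    by rewrite ler_pM2l.
  have tn : t n <= t m'.
    rewrite lerB// !seriesEnat/= (big_cat_nat (leq0n m') m'n)//= lerDl.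
    exact: sumr_ge0.
  have p2 : `|p n x| <= 3 / 2.
    have -> : p n x = (p n x - 1) + 1 by ring.
    rewrite (le_trans (ler_normD _ _))// normr1.
    have : `|p n x - 1| <= 2 * t m' by apply: dist1 => //; lra.
    lra.
  rewrite /p (big_cat_nat m'n)//= -/(p n x) -[X in _ * _ - X]mulr1 -mulrBr normrM.
  have : `|\prod_(n <= j < n') f j x - 1| <= 2 * t n by apply: dist1 => //; lra.
  move=> H; apply: (@le_trans _ _ (3 / 2 * (2 * t n))); last by lra.
  by rewrite ler_pM.
pose g x := limn (p ^~ x).
have p_cvg x : K x -> p ^~ x @ \oo --> g x.
  move=> Kx; apply: cauchy_cvg; apply: cauchy_exP => e e0.
  have [k _ Hk] : \forall n \near \oo, t n < e / 3.
    by apply: t_small; rewrite divr_gt0.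
  exists (p (maxn m' k) x).
  suff : \forall n \near \oo, ball (p (maxn m' k) x) e (p n x) by [].
  near=> n.
  rewrite /ball/= distrC (le_lt_trans (@p_step (maxn m' k) n x Kx _ _)) ?leq_maxl//.
    by near: n; exact: nbhs_infty_ge.
  by have := Hk _ (leq_maxr m' k); lra.
have g_dist n x : K x -> (m' <= n)%N -> `|g x - p n x| <= 3 * t n.
  move=> Kx m'n.
  have h : (fun k => `|p k x - p n x|) @ \oo --> `|g x - p n x|.
    by apply: cvg_norm; apply: cvgB; [exact: p_cvg|exact: cvg_cst].
  rewrite -(cvg_lim _ h)//; apply: limr_le; first exact: cvgP h.
  by exists n => // k /= nk; exact: p_step.
have g_unif (e : R) : 0 < e ->
    \forall n \near \oo, forall x, K x -> `|g x - p n x| < e.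
  move=> e0; near=> n; move=> x Kx.
  have m'n : (m' <= n)%N by near: n; exact: nbhs_infty_ge.
  rewrite (le_lt_trans (g_dist _ _ Kx m'n))// mulrC -ltr_pdivlMr//.
  by near: n; apply: t_small; rewrite divr_gt0.
pose H x := \prod_(0 <= j < m') f j x.
have [B B0 HB] : exists2 B, 0 < B & forall x, K x -> `|H x| <= B.
  rewrite /H; elim: (m') => [|k [B B0 IH]].
    by exists 1 => // x _; rewrite big_geq// normr1.
  have [C fC] := bndf k; exists (B * (`|C| + 1)) => [|x Kx].
    by rewrite mulr_gt0// ltr_wpDl.
  rewrite big_nat_recr//= normrM ler_pM ?IH//.
  by rewrite (le_trans (fC _ Kx))// (le_trans (ler_norm _))// lerDl.
have infprodE x : K x -> infprod f x = H x * g x.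
  move=> Kx; apply: cvg_lim => //.
  have : (fun n => H x * p n x) @ \oo --> H x * g x.
    by apply: cvgM; [exact: cvg_cst|exact: p_cvg].
  apply: cvg_trans; apply: near_eq_cvg.
  by exists m' => // n /= m'n; rewrite [RHS](big_cat_nat (leq0n m') m'n).
split.
  apply/uniform_cvg_normP => e e0; near=> n; move=> x Kx.
  have m'n : (m' <= n)%N by near: n; exact: nbhs_infty_ge.
  rewrite infprodE// (big_cat_nat (leq0n m') m'n)//=.
  rewrite -/(H x) -/(p n x) -mulrBr normrM.
  apply: (@le_lt_trans _ _ (B * `|g x - p n x|)).
    by rewrite ler_wpM2r// HB.
  rewrite mulrC -ltr_pdivlMr//; move: x Kx; near: n.
  by apply: g_unif; rewrite divr_gt0.
exists m', g; split=> [x Kx|]; last exact/uniform_cvg_normP.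
have := g_dist m' x Kx (leqnn _).
rewrite /p big_geq// => h; apply/eqP => gx0; move: h.
by rewrite gx0 sub0r normrN normr1; lra.
Unshelve. all: by end_near. Qed.

(** Continuity makes the first [m] factors bounded near [x0], and the majorant
    bounds the others, so the Weierstrass test applies on a whole neighbourhood
    of [x0], and the limit is approximated there by continuous finite products. *)
Lemma infprod_continuous_at {R : realType} {T : topologicalType}
    (f : nat -> T -> R) (b : nat -> R) (m : nat) (x0 : T) :
  (forall j, 0 <= b j) -> cvgn (series b) ->
  (\forall x \near x0, forall j, (m <= j)%N -> `|f j x - 1| <= b j) ->
  (forall j, {for x0, continuous (f j)}) ->
  {for x0, continuous (infprod f)}.
Proof.
move=> b0 cb fb cf.
pose V := [set x | (forall j, (m <= j)%N -> `|f j x - 1| <= b j) /\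
  forall j, (j < m)%N -> `|f j x| <= `|f j x0| + 1].
have bnd n : \forall x \near x0, forall j, (j < n)%N -> `|f j x| <= `|f j x0| + 1.
  elim: n => [|n IH]; first by near=> x.
  have h : \forall x \near x0, `|f n x| <= `|f n x0| + 1.
    apply: (cvgr_le `|f n x0|); last by rewrite ltrDl.
    by apply: cvg_norm; exact: cf.
  near=> x => j; rewrite ltnS leq_eqVlt => /predU1P[->|jn]; first by near: x.
  by move: j jn; near: x.
have nV : nbhs x0 V by apply: filterS2 fb (bnd m) => x; split.
have [/uniform_cvg_normP unif _] : prod_unif_cvg V f.
  apply: (@prod_unif_cvg_summable _ _ V f b m) => // [j x mj [+ _]|j]; first exact.
  have [mj|jm] := leqP m j.
    exists (b j + 1) => x [/(_ j mj) fj _].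
    have -> : f j x = (f j x - 1) + 1 by ring.
    by rewrite (le_trans (ler_normD _ _))// normr1 lerD2r.
  by exists (`|f j x0| + 1) => x [_ /(_ j jm)].
have Vx0 : V x0 by exact: nbhs_singleton.
apply/cvgrPdist_lt => e e0.
have e3 : 0 < e / 3 by rewrite divr_gt0.
have [n _ /(_ n (leqnn _)) Hn] := unif _ e3.
have cp : (fun x => \prod_(0 <= j < n) f j x) @ x0 --> \prod_(0 <= j < n) f j x0.
  elim: (n) => [|k IH].
    under eq_fun do rewrite big_geq//; rewrite big_geq//; exact: cvg_cst.
  under eq_fun do rewrite big_nat_recr//=; rewrite big_nat_recr//=.
  by apply: cvgM => //; exact: cf.
near=> x.
have Vx : V x by near: x.
have h1 := Hn _ Vx0; have h2 := Hn _ Vx.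
have h3 : `|\prod_(0 <= j < n) f j x0 - \prod_(0 <= j < n) f j x| < e / 3.
  by near: x; move/cvgrPdist_lt : cp; exact.
rewrite distrC in h2.
set u := infprod f x0 in h1 *; set v := infprod f x in h2 *.
set p := \prod_(_ <= _ < _) _ in h1 h3; set p' := \prod_(_ <= _ < _) _ in h2 h3.
have -> : u - v = (u - p) + (p - p') + (p' - v) by ring.
by rewrite (le_lt_trans (ler_normD _ _))//; have := ler_normD (u - p) (p - p'); lra.
Unshelve. all: by end_near. Qed.

(** * Estimates for the sine *)

Section SineEstimates.
Context {R : realType}.
Implicit Types x y : R.

Lemma sin_lipschitz x y : `|sin x - sin y| <= `|x - y|.
Proof.
wlog yx : x y / y <= x.
  move=> H; have [yx|xy] := leP y x; first exact: H.
  by rewrite distrC [leRHS]distrC H// ltW.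
have [c _ ->] : exists2 c, c \in `[y, x] & sin x - sin y = cos c * (x - y).
  apply: (@MVT_segment R sin cos) => //.
  exact/continuous_subspaceT/continuous_sin.
by rewrite normrM ler_piMl// cos_max.
Qed.

Lemma sin_le_norm x : `|sin x| <= `|x|.
Proof. by have := sin_lipschitz x 0; rewrite sin0 !subr0. Qed.

Lemma cos_half x : cos x = 1 - 2 * sin (x / 2) ^+ 2.
Proof.
have -> : cos x = cos ((x / 2) *+ 2) by congr cos; rewrite -mulr_natr divfK.
by rewrite cos_mulr2n cos2sin2 -mulr_natr; ring.
Qed.

Lemma sin_half x : sin x = 2 * (sin (x / 2) * cos (x / 2)).
Proof.
have -> : sin x = sin ((x / 2) *+ 2) by congr sin; rewrite -mulr_natr divfK.
by rewrite sin_mulr2n -mulr_natr; ring.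
Qed.

(** Mean value theorem for [sin z - z], whose derivative [cos c - 1] equals
    [- 2 sin^2 (c / 2)], of absolute value at most [x^2 / 2]. *)
Lemma sin_sub_le x : `|sin x - x| <= `|x| ^+ 3.
Proof.
wlog x0 : x / 0 <= x.
  move=> H; have [/H//|x0] := leP 0 x.
  have := H (- x); rewrite oppr_ge0 normrN sinN => /(_ (ltW x0)).
  by rewrite -opprB normrN opprK addrC.
have [c] : exists2 c, c \in `[0, x] &
    (sin x - x) - (sin 0 - 0) = (cos c - 1) * (x - 0).
  apply: (@MVT_segment R (fun z => sin z - z) (fun z => cos z - 1)) => //.
  apply: continuous_subspaceT => z.
  by apply: cvgB; [exact: continuous_sin|exact: cvg_id].
rewrite in_itv/= => /andP[c0 cx]; rewrite sin0 !subr0 => ->.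
rewrite normrM exprSr ler_wpM2r// cos_half.
have s2 : 0 <= sin (c / 2) ^+ 2 by exact: sqr_ge0.
have -> : 1 - 2 * sin (c / 2) ^+ 2 - 1 = - (2 * sin (c / 2) ^+ 2) by ring.
rewrite normrN ger0_norm ?(mulr_ge0 _ s2)//.
have : sin (c / 2) ^+ 2 <= (c / 2) ^+ 2.
  rewrite -real_normK ?num_real// -[leRHS]real_normK ?num_real//.
  by rewrite lerXn2r ?nnegrE ?sin_le_norm.
have : c ^+ 2 <= `|x| ^+ 2 by rewrite lerXn2r ?nnegrE// ger0_norm.
rewrite expr_div_n; have : 0 <= c ^+ 2 by exact: sqr_ge0.
lra.
Qed.

Lemma sin_int_pi (k : R) : k \is a Num.int -> sin (k * pi) = 0.
Proof.
have sin_nat (n : nat) : sin (n%:R * pi : R) = 0.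
  by elim: n => [|n IH]; rewrite ?mul0r ?sin0// -natr1 mulrDl mul1r sinDpi IH oppr0.
move=> /intrP[[n|n] ->]; first exact: sin_nat.
by rewrite NegzE mulrNz mulNr sinN sin_nat oppr0.
Qed.

(** Subtracting the multiple of [pi] below [x] leaves a zero of the sine in
    [[0, pi)], where the sine is positive except at the origin. *)
Lemma sin_eq0_int x : sin x = 0 -> x / pi \is a Num.int.
Proof.
have pi0 := pi_gt0 R.
set k : R := (Num.floor (x / pi))%:~R => sx.
have kint : k \is a Num.int by exact: intr_int.
have /andP[kx xk] : k <= x / pi < k + 1.
  by have := floor_itv (x / pi); rewrite intrD.
have : sin (x - k * pi) = 0 by rewrite sinB sx (sin_int_pi _ kint); ring.
have r0 : 0 <= x - k * pi by rewrite subr_ge0 -ler_pdivlMr.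
have rpi : x - k * pi < pi.
  by rewrite ltrBlDl -[X in _ + X]mul1r -mulrDl -ltr_pdivrMr.
move: r0; rewrite le_eqVlt => /predU1P[r0 _|r0 /eqP].
  by have -> : x = k * pi by [lra|]; rewrite mulfK// gt_eqF.
by rewrite gt_eqF// sin_gt0_pi// r0.
Qed.

Lemma sinD_int2pi (k : R) x : k \is a Num.int -> sin (x + 2 * pi * k) = sin x.
Proof.
move=> kint; have -> : 2 * pi * k = k * (pi *+ 2) by rewrite -mulr_natr; ring.
have sk := sin_int_pi _ kint.
rewrite sinD (sin_half (k * _)) (cos_half (k * _)).
have -> : k * (pi *+ 2) / 2 = k * pi by rewrite -mulr_natr; field.
by rewrite sk; ring.
Qed.

Lemma sqr_sin_halfD_int2pi (k : R) x : k \is a Num.int ->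
  sin ((x + 2 * pi * k) / 2) ^+ 2 = sin (x / 2) ^+ 2.
Proof.
move=> kint; have -> : (x + 2 * pi * k) / 2 = x / 2 + k * pi by field.
rewrite sinD (sin_int_pi _ kint) mulr0 addr0 exprMn cos2sin2.
by rewrite (sin_int_pi _ kint); ring.
Qed.

End SineEstimates.

(** * Norms of vectors and quadratic forms *)

Section MatrixNorm.
Context {R : realType}.

Lemma cV_coord_le {d : nat} (x : 'cV[R]_d) i : `|x i 0| <= `|x|.
Proof.
rewrite [leRHS]/Num.norm /= mx_normrE.
by apply: (le_bigmax _ (fun ij : 'I_d * 'I_1 => `|x ij.1 ij.2|) (i, 0)).
Qed.

Lemma cV_norm_le {d : nat} (x : 'cV[R]_d) c :
  0 <= c -> (forall i, `|x i 0| <= c) -> `|x| <= c.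
Proof.
move=> c0 xc; rewrite [leLHS]/Num.norm /= mx_normrE.
by apply/bigmax_leP; split=> // -[i j] _ /=; rewrite ord1.
Qed.

Lemma mulmx_norm_bound {m d : nat} (C : 'M[R]_(m, d)) :
  exists2 L, 0 <= L & forall x : 'cV[R]_d, `|C *m x| <= L * `|x|.
Proof.
have sum0 i : 0 <= \sum_j `|C i j| by exact: sumr_ge0.
exists (\sum_i \sum_j `|C i j|) => [|x]; first exact: sumr_ge0.
apply: cV_norm_le => [|i]; first by rewrite mulr_ge0// sumr_ge0.
rewrite mxE (le_trans (ler_norm_sum _ _ _))//.
apply: (@le_trans _ _ (\sum_j `|C i j| * `|x|)).
  by apply: ler_sum => j _; rewrite normrM ler_wpM2l// cV_coord_le.
by rewrite -mulr_suml ler_wpM2r// (bigD1 i)//= lerDl sumr_ge0.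
Qed.

Definition sqnorm {d : nat} (v : 'cV[R]_d) : R := (v^T *m v) 0 0.

Lemma sqnormE {d : nat} (v : 'cV[R]_d) : sqnorm v = \sum_i v i 0 ^+ 2.
Proof. by rewrite /sqnorm mxE; apply: eq_bigr => i _; rewrite mxE expr2. Qed.

Lemma sqnorm_ge0 {d : nat} (v : 'cV[R]_d) : 0 <= sqnorm v.
Proof. by rewrite sqnormE sumr_ge0// => i _; exact: sqr_ge0. Qed.

Lemma sqnormZ {d : nat} c (v : 'cV[R]_d) : sqnorm (c *: v) = c ^+ 2 * sqnorm v.
Proof.
by rewrite !sqnormE mulr_sumr; apply: eq_bigr => i _; rewrite mxE exprMn.
Qed.

Lemma norm_le_sqnorm {d : nat} (v : 'cV[R]_d) : `|v| ^+ 2 <= sqnorm v.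
Proof.
rewrite -[leRHS]sqr_sqrtr ?sqnorm_ge0// lerXn2r ?nnegrE ?sqrtr_ge0//.
apply: cV_norm_le => [|i]; first exact: sqrtr_ge0.
rewrite -sqrtr_sqr ler_wsqrtr// sqnormE (bigD1 i)//= lerDl.
by apply: sumr_ge0 => j _; exact: sqr_ge0.
Qed.

Lemma sqnorm_le_norm {d : nat} (v : 'cV[R]_d) : sqnorm v <= d%:R * `|v| ^+ 2.
Proof.
rewrite sqnormE; apply: (@le_trans _ _ (\sum_(i < d) `|v| ^+ 2)).
  apply: ler_sum => i _; rewrite -real_normK ?num_real//.
  by rewrite lerXn2r ?nnegrE// cV_coord_le.
by rewrite sumr_const card_ord mulr_natl.
Qed.

Lemma sqnorm_orthogonal {d : nat} (U : 'M[R]_d) (v : 'cV[R]_d) :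
  orthogonalmx U -> sqnorm (U *m v) = sqnorm v.
Proof.
by move=> UU; rewrite /sqnorm trmx_mul -mulmxA (mulmxA U^T) UU mul1mx.
Qed.

Lemma posdefmx_unit {d : nat} (Q : 'M[R]_d) : posdefmx Q -> Q \in unitmx.
Proof.
move=> [Qt Qpos]; rewrite -row_free_unit; apply: inj_row_free => v vQ.
apply/eqP/negPn/negP => v0.
have /Qpos : v^T != 0 by rewrite -(trmx0 _ 1 d) (inj_eq trmx_inj).
by rewrite trmxK vQ mul0mx mxE ltxx.
Qed.

Lemma unitmx_sqnorm_lower {d : nat} (Q : 'M[R]_d) : Q \in unitmx ->
  exists2 c, 0 < c & forall x, c * `|x| ^+ 2 <= sqnorm (Q *m x).
Proof.
move=> Qu; have [L L0 HL] := mulmx_norm_bound (invmx Q).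
have L1 : 0 < L + 1 by rewrite ltr_wpDl.
(* [L] may be zero, hence [L + 1]. *)
exists ((L + 1) ^- 2) => [|x]; first by rewrite invr_gt0 exprn_gt0.
apply: le_trans (norm_le_sqnorm _).
rewrite ler_pdivrMl ?exprn_gt0// -exprMn lerXn2r ?nnegrE ?mulr_ge0 ?(ltW L1)//.
have := HL (Q *m x); rewrite mulKmx// => /le_trans; apply.
by rewrite ler_wpM2r// lerDl.
Qed.

End MatrixNorm.

(** * The function G *)

Lemma sum_offdiag_sym {R : comPzRingType} {d : nat} (a : 'I_d -> 'I_d -> R) :
  (forall i j, a i j = a j i) ->
  \sum_i \sum_j a i j =
    \sum_i a i i + 2 * \sum_(i < d) \sum_(j < d | (i < j)%N) a i j.
Proof.
move=> a_sym.
have split_row i : \sum_j a i j =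
    a i i + (\sum_(j < d | (i < j)%N) a i j + \sum_(j < d | (j < i)%N) a i j).
  rewrite (bigD1 i)//= (bigID (fun j : 'I_d => (i < j)%N))/=; congr (_ + (_ + _)).
    by apply: eq_bigl => j; rewrite -val_eqE/=; case: ltngtP.
  by apply: eq_bigl => j; rewrite -val_eqE/=; case: ltngtP.
under eq_bigr do rewrite split_row.
rewrite !big_split/=; congr (_ + _).
have -> : \sum_(i < d) \sum_(j < d | (j < i)%N) a i j =
          \sum_(i < d) \sum_(j < d | (i < j)%N) a i j.
  rewrite (exchange_big_dep xpredT)//=.
  by apply: eq_bigr => i _; apply: eq_bigr => j _; exact: a_sym.
ring.
Qed.

Section SymbolG.
Context {R : realType} {d : nat} (Q : 'M[R]_d).
Hypothesis Qpos : posdefmx Q.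

Lemma gram_sym i j : (Q *m Q) i j = (Q *m Q) j i.
Proof. by rewrite -[in LHS]Qpos.1 -trmx_mul mxE. Qed.

Lemma gram_diag_gt0 i : 0 < (Q *m Q) i i.
Proof.
have e0 : (delta_mx i 0 : 'cV[R]_d) != 0.
  by apply/eqP => /matrixP/(_ i 0); rewrite !mxE !eqxx/= => /eqP; rewrite oner_eq0.
have := Qpos.2 _ e0; rewrite -mulmxA -colE trmx_delta -rowE !mxE => Qii.
rewrite (bigD1 i)//= ltr_pwDl ?mulr_gt0//.
apply: sumr_ge0 => j _.
have <- : Q i j = Q j i by rewrite -[in LHS]Qpos.1 mxE.
by rewrite -expr2 sqr_ge0.
Qed.

Lemma sqnorm_gramE (v : 'cV[R]_d) :
  sqnorm (Q *m v) = \sum_i \sum_j (Q *m Q) i j * v i 0 * v j 0.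
Proof.
rewrite /sqnorm trmx_mul Qpos.1 mulmxA -(mulmxA v^T) -mulmxA mxE.
apply: eq_bigr => i _; rewrite !mxE mulr_sumr.
by apply: eq_bigr => j _; rewrite mulrA (mulrC (v i 0)).
Qed.

(** This form exhibits [G] as a sum of nonnegative terms, and shows at the same
    time its zeros and its quadratic part. It comes from
    [4 sin^2 (t / 2) = sin^2 t + 4 sin^4 (t / 2)], which turns the diagonal terms
    of [G] into those of the quadratic form of [Q^2] at [sin x]. *)
Lemma G_sqnormE x : G Q x =
  sqnorm (Q *m map_mx sin x) +
  4 * \sum_i (Q *m Q) i i * sin (x i 0 / 2) ^+ 4.
Proof.
rewrite sqnorm_gramE sum_offdiag_sym; last first.
  by move=> i j; rewrite gram_sym -!mulrA (mulrC (map_mx _ _ _ _)).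
rewrite /G addrAC; congr (_ + _); last first.
  congr (_ * _); apply: eq_bigr => i _; apply: eq_bigr => j _.
  by rewrite ![map_mx _ _ _ _]mxE.
rewrite !mulr_sumr -big_split/=; apply: eq_bigr => i _.
rewrite [map_mx _ _ _ _]mxE (sin_half (x i 0)).
have := cos2sin2 (x i 0 / 2).
set s := sin _; set c := cos _ => hc.
by rewrite -mulrA -expr2 !exprMn hc; ring.
Qed.

Lemma G_periodic x k : Zd k -> G Q (x + (2 * pi) *: k) = G Q x.
Proof.
move=> kint; rewrite /G; congr (_ * _ + _ * _).
  by apply: eq_bigr => i _; rewrite !mxE sqr_sin_halfD_int2pi//; exact: kint.
apply: eq_bigr => i _; apply: eq_bigr => j _.
by rewrite !mxE !sinD_int2pi//; exact: kint.
Qed.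

Lemma G0 : G Q 0 = 0.
Proof.
have coord0 i : (0 : 'cV[R]_d) i 0 = 0 by rewrite mxE.
rewrite /G big1 => [|i _]; last by rewrite coord0 mul0r sin0 expr0n mulr0.
rewrite big1 => [|i _]; first by rewrite !mulr0 addr0.
by rewrite big1// => j _; rewrite !coord0 sin0 mulr0.
Qed.

(** As the diagonal entries of [Q^2] are positive, a zero of [G] has
    [sin (x_i / 2) = 0] for every [i]. *)
Lemma G_eq0 x : (G Q x == 0) = (x \in [set (2 * pi) *: k | k in @Zd R d]).
Proof.
have pi0 := pi_gt0 R; have pi2 : 2 * pi != 0 :> R by rewrite mulf_neq0// gt_eqF.
apply/idP/idP => [|/set_mem[k kint <-]]; last first.
  by rewrite -[_ *: k]add0r G_periodic// G0.
have term0 i : 0 <= (Q *m Q) i i * sin (x i 0 / 2) ^+ 4.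
  by rewrite mulr_ge0 ?(ltW (gram_diag_gt0 i))// (exprM _ 2 2) sqr_ge0.
rewrite G_sqnormE paddr_eq0 ?sqnorm_ge0//; last by rewrite mulr_ge0// sumr_ge0.
rewrite mulf_eq0 pnatr_eq0/= => /andP[_].
rewrite psumr_eq0// => /allP/= G0i.
apply/mem_set; exists ((2 * pi)^-1 *: x); last by rewrite scalerA divff// scale1r.
move=> i; have /G0i/= := mem_index_enum i.
rewrite mulf_eq0 gt_eqF ?gram_diag_gt0//= expf_eq0/= => /eqP/sin_eq0_int h.
by rewrite mxE invfM mulrC mulrA.
Qed.

(** The error is of order 4, not 3, because [sin t - t = O(t^3)] enters only in
    products with a factor that is itself [O(t)]. *)
Lemma G_sqnorm_dist : exists2 C, 0 <= C &
  forall x, `|G Q x - sqnorm (Q *m x)| <= C * `|x| ^+ 4.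
Proof.
pose C1 := \sum_i \sum_j `|(Q *m Q) i j|; pose C2 := \sum_i `|(Q *m Q) i i|.
have C10 : 0 <= C1 by apply: sumr_ge0 => i _; exact: sumr_ge0.
have C20 : 0 <= C2 by exact: sumr_ge0.
exists (C1 * 2 + 4 * C2) => [|x].
  by rewrite addr_ge0// mulr_ge0.
have sin_le i : `|sin (x i 0)| <= `|x|.
  exact: le_trans (sin_le_norm _) (cV_coord_le _ _).
have sin_sub i : `|sin (x i 0) - x i 0| <= `|x| ^+ 3.
  apply: le_trans (sin_sub_le _) _.
  by rewrite lerXn2r ?nnegrE ?cV_coord_le.
have prod_sub i j : `|sin (x i 0) * sin (x j 0) - x i 0 * x j 0| <= 2 * `|x| ^+ 4.
  have -> : sin (x i 0) * sin (x j 0) - x i 0 * x j 0 =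
    sin (x i 0) * (sin (x j 0) - x j 0) + (sin (x i 0) - x i 0) * x j 0 by ring.
  rewrite (le_trans (ler_normD _ _))// !normrM mulr_natl mulr2n lerD//.
    by rewrite [leRHS]exprS ler_pM.
  by rewrite [leRHS]exprSr ler_pM// cV_coord_le.
have sin_half4 i : `|sin (x i 0 / 2) ^+ 4| <= `|x| ^+ 4.
  rewrite normrX lerXn2r ?nnegrE// (le_trans (sin_le_norm _))//.
  rewrite (le_trans _ (cV_coord_le x i))// normrM normfV normr_nat.
  by rewrite ler_pdivrMr// ler_peMr// ler1n.
rewrite G_sqnormE !sqnorm_gramE addrAC (le_trans (ler_normD _ _))//.
rewrite [leRHS]mulrDl lerD//.
  rewrite -sumrB (le_trans (ler_norm_sum _ _ _))//.
  rewrite -mulrA mulr_suml ler_sum// => i _.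
  rewrite -sumrB (le_trans (ler_norm_sum _ _ _))//.
  rewrite mulr_suml ler_sum// => j _.
  by rewrite ![map_mx _ _ _ _]mxE -!mulrA -mulrBr normrM ler_wpM2l.
rewrite normrM ger0_norm// -mulrA ler_wpM2l//.
rewrite (le_trans (ler_norm_sum _ _ _))// mulr_suml ler_sum// => i _.
by rewrite normrM ler_wpM2l.
Qed.

End SymbolG.

(** * Bounded Lipschitz functions *)

Lemma near_dist_lt {R : realType} {V : normedModType R} (x : V) (e : R) :
  0 < e -> \forall y \near x, `|x - y| < e.
Proof. by move=> e0; apply: cvgr_dist_lt => //; exact: cvg_id. Qed.

Lemma lipschitz_continuous {R : realType} {V W : normedModType R} (f : V -> W)
    (C : R) :
  0 <= C -> (forall x y, `|f x - f y| <= C * `|x - y|) -> continuous f.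
Proof.
move=> C0 fL x; apply/cvgrPdist_lt => e e0.
have C1 : 0 < C + 1 by rewrite ltr_wpDl.
near=> y; apply: le_lt_trans (fL _ _) _.
apply: (@le_lt_trans _ _ ((C + 1) * `|x - y|)); first by rewrite ler_wpM2r// lerDl.
rewrite mulrC -ltr_pdivlMr//.
by near: y; apply: near_dist_lt; rewrite divr_gt0.
Unshelve. all: by end_near. Qed.

Section BoundedLipschitz.
Context {R : realType} {V : normedModType R}.
Implicit Types f g : V -> R.

(** Boundedness is part of the notion so that it is stable under products, and
    therefore passes from the sine to [G] and [m0]. *)
Definition bounded_lipschitz f := exists C, [/\ 0 <= C,
  forall x, `|f x| <= C & forall x y, `|f x - f y| <= C * `|x - y|].

Lemma bounded_lipschitz_cst c : bounded_lipschitz (fun=> c).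
Proof. by exists `|c|; split=> // x y; rewrite subrr normr0 mulr_ge0. Qed.

Lemma bounded_lipschitzD f g : bounded_lipschitz f -> bounded_lipschitz g ->
  bounded_lipschitz (fun x => f x + g x).
Proof.
move=> [C [C0 fC fL]] [D [D0 gD gL]]; exists (C + D); split=> [|x|x y].
- exact: addr_ge0.
- by rewrite (le_trans (ler_normD _ _))// lerD.
- rewrite opprD addrACA mulrDl (le_trans (ler_normD _ _))// lerD//.
Qed.

Lemma bounded_lipschitzM f g : bounded_lipschitz f -> bounded_lipschitz g ->
  bounded_lipschitz (fun x => f x * g x).
Proof.
move=> [C [C0 fC fL]] [D [D0 gD gL]]; exists (2 * (C * D)); split=> [|x|x y].
- by rewrite mulr_ge0// mulr_ge0.
- apply: (@le_trans _ _ (C * D)); first by rewrite normrM ler_pM.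
  by rewrite ler_peMl ?mulr_ge0// ler1n.
- have -> : f x * g x - f y * g y = f x * (g x - g y) + (f x - f y) * g y by ring.
  rewrite (le_trans (ler_normD _ _))// !normrM.
  have h1 : `|f x| * `|g x - g y| <= C * (D * `|x - y|) by rewrite ler_pM.
  have h2 : `|f x - f y| * `|g y| <= C * `|x - y| * D by rewrite ler_pM// mulr_ge0.
  apply: le_trans (lerD h1 h2) _; rewrite le_eqVlt.
  by apply/orP; left; apply/eqP; ring.
Qed.

Lemma bounded_lipschitz_sum {I : Type} (r : seq I) (P : pred I) (F : I -> V -> R) :
  (forall i, bounded_lipschitz (F i)) ->
  bounded_lipschitz (fun x => \sum_(i <- r | P i) F i x).
Proof.
move=> HF; elim: r => [|i r IH].
  by under eq_fun do rewrite big_nil; exact: bounded_lipschitz_cst.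
under eq_fun do rewrite big_cons.
by case: (P i) => //; exact: bounded_lipschitzD.
Qed.

Lemma bounded_lipschitz_prod {I : Type} (r : seq I) (F : I -> V -> R) :
  (forall i, bounded_lipschitz (F i)) ->
  bounded_lipschitz (fun x => \prod_(i <- r) F i x).
Proof.
move=> HF; elim: r => [|i r IH].
  by under eq_fun do rewrite big_nil; exact: bounded_lipschitz_cst.
by under eq_fun do rewrite big_cons; exact: bounded_lipschitzM.
Qed.

Lemma bounded_lipschitz_continuous f : bounded_lipschitz f -> continuous f.
Proof. by move=> [C [C0 _ fL]]; exact: lipschitz_continuous C0 fL. Qed.

Lemma bounded_lipschitz_div_continuous {f g} {x : V} :
  bounded_lipschitz f -> bounded_lipschitz g -> g x != 0 ->
  {for x, continuous (fun y => f y / g y)}.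
Proof.
move=> fbl gbl gx; apply: cvgM; first exact: bounded_lipschitz_continuous.
by apply: cvgV => //; exact: bounded_lipschitz_continuous.
Qed.

Lemma continuous_at_dist f (x : V) :
  (forall e, 0 < e -> \forall y \near x, `|f x - f y| < e) ->
  {for x, continuous f}.
Proof. by move=> fx; apply/cvgrPdist_lt. Qed.

Lemma bounded_lipschitz_near_neq0 {f} {x : V} :
  bounded_lipschitz f -> f x != 0 -> \forall y \near x, f y != 0.
Proof. by move=> /bounded_lipschitz_continuous/(_ x); exact: cvgr_neq0. Qed.

Lemma near_eq_continuous f g (x : V) : (\forall y \near x, f y = g y) ->
  {for x, continuous f} -> {for x, continuous g}.
Proof.
move=> fg fcont; have fgx : f x = g x by exact: nbhs_singleton fg.
rewrite /prop_for /continuous_at -fgx.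
by apply: cvg_trans fcont; exact: near_eq_cvg.
Qed.

End BoundedLipschitz.

Lemma bounded_lipschitz_affine {R : realType} {d m : nat} (f : 'cV[R]_m -> R)
    (C : 'M[R]_(m, d)) (v : 'cV[R]_m) :
  bounded_lipschitz f -> bounded_lipschitz (fun x : 'cV[R]_d => f (C *m x + v)).
Proof.
move=> [D [D0 fD fL]]; have [L L0 CL] := mulmx_norm_bound C.
exists (D * (L + 1)); split=> [|x|x y].
- by rewrite mulr_ge0// addr_ge0.
- by rewrite (le_trans (fD _))// ler_peMr// lerDr.
- rewrite (le_trans (fL _ _))// -mulrA ler_wpM2l//.
  rewrite opprD addrACA subrr addr0 -mulmxBr (le_trans (CL _))//.
  by rewrite ler_wpM2r// lerDl.
Qed.

Lemma bounded_lipschitz_sin {R : realType} {d : nat} (c : R) (i : 'I_d) :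
  bounded_lipschitz (fun x : 'cV[R]_d => sin (x i 0 * c)).
Proof.
exists (1 + `|c|); split=> [|x|x y]; first by rewrite addr_ge0.
  by rewrite (le_trans (sin_max _))// lerDl.
rewrite (le_trans (sin_lipschitz _ _))// -mulrBl normrM mulrC.
apply: ler_pM => //; first by rewrite lerDr.
by have := cV_coord_le (x - y) i; rewrite !mxE.
Qed.

Lemma bounded_lipschitz_G {R : realType} {d : nat} (Q : 'M[R]_d) :
  bounded_lipschitz (G Q).
Proof.
have lip_sin (i : 'I_d) : bounded_lipschitz (fun x : 'cV[R]_d => sin (x i 0)).
  rewrite (_ : (fun _ => _) = (fun x : 'cV[R]_d => sin (x i 0 * 1))).
    exact: bounded_lipschitz_sin.
  by apply/funext => x; rewrite mulr1.
rewrite /G; apply: bounded_lipschitzD; apply: bounded_lipschitzM;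
  try exact: bounded_lipschitz_cst; apply: bounded_lipschitz_sum => i.
  apply: bounded_lipschitzM; first exact: bounded_lipschitz_cst.
  under eq_fun do rewrite expr2.
  by apply: bounded_lipschitzM; exact: bounded_lipschitz_sin.
apply: bounded_lipschitz_sum => j; apply: bounded_lipschitzM => //.
by apply: bounded_lipschitzM => //; exact: bounded_lipschitz_cst.
Qed.

(** * The digit set S(A^T) and the mask *)

Section DualLattice.
Context {R : realType} {d : nat} (A : 'M[int]_d).
Hypothesis Aunit : Defs.realmx R A \in unitmx.
Implicit Types x y k s w : 'cV[R]_d.

Lemma ZdB x y : Zd x -> Zd y -> Zd (x - y).
Proof. by move=> xZ yZ i; rewrite !mxE rpredB. Qed.

Lemma ZdN x : Zd x -> Zd (- x).
Proof. by move=> xZ i; rewrite mxE rpredN. Qed.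

Lemma ZdD x y : Zd x -> Zd y -> Zd (x + y).
Proof. by move=> xZ yZ i; rewrite !mxE rpredD. Qed.

Lemma Zd_mulAT x : Zd x -> Zd ((Defs.realmx R A)^T *m x).
Proof.
move=> xZ i; rewrite mxE rpred_sum// => j _.
by rewrite rpredM// !mxE intr_int.
Qed.

Lemma mulAT_invT x : (Defs.realmx R A)^T *m (invT R A *m x) = x.
Proof. by rewrite /invT mulKVmx// unitmx_tr. Qed.

Lemma invT_mulAT x : invT R A *m ((Defs.realmx R A)^T *m x) = x.
Proof. by rewrite /invT mulKmx// unitmx_tr. Qed.

Lemma finite_int_box (N : nat) :
  finite_set [set x : 'cV[R]_d | Zd x /\ forall i, `|x i 0| <= N%:R].
Proof.
(* Shifting the coordinates by [N] encodes them as elements of [0, 2N]. *)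
pose phi (f : {ffun 'I_d -> 'I_(N + N).+1}) : 'cV[R]_d :=
  \col_i ((f i)%:R - N%:R).
apply: (@sub_finite_set _ _ [set phi f | f in [set: {ffun 'I_d -> 'I_(N + N).+1}]]).
  move=> x [xZ xN]; exists [ffun i => inord (Num.truncn (x i 0 + N%:R))] => //.
  apply/colP => i; rewrite mxE ffunE.
  have := xN i; rewrite ler_norml => /andP[Nx xN'].
  have xN0 : 0 <= x i 0 + N%:R by rewrite -lerBlDr sub0r.
  have xNnat : x i 0 + N%:R \is a Num.nat by rewrite natrEint xN0 rpredD// intr_nat.
  rewrite inordK; first by rewrite truncnK// addrK.
  by rewrite ltnS -(ler_nat R) truncnK// natrD lerD2r.
exact/finite_image/finite_finset.
Qed.

(** [A^T s] is an integral vector, bounded because [s] lies in the unit cube, and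
    it determines [s]. *)
Lemma finite_SAT : finite_set (@SAT R d A).
Proof.
have [L L0 AL] := mulmx_norm_bound (Defs.realmx R A)^T.
have := finite_int_box (Num.truncn L).+1 => /(finite_image (mulmx (invT R A))).
apply: sub_finite_set => s [s01 sZ].
exists ((Defs.realmx R A)^T *m s); last by rewrite invT_mulAT.
split=> // i; rewrite (le_trans (cV_coord_le _ _))// (le_trans (AL _))//.
apply: (@le_trans _ _ L); last exact/ltW/truncnS_gt.
rewrite ler_piMr// cV_norm_le// => j.
by have /andP[s0 s1] := s01 j; rewrite ger0_norm// ltW.
Qed.

Lemma SAT0 : SAT A (0 : 'cV[R]_d).
Proof.
split=> [i|]; first by rewrite mxE lexx ltr01.
by rewrite mulmx0 => i; rewrite mxE rpred0.
Qed.

Definition frac_vec x : 'cV[R]_d := \col_i (x i 0 - (Num.floor (x i 0))%:~R).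

Lemma frac_vec_bounds x i : 0 <= frac_vec x i 0 < 1.
Proof.
rewrite mxE subr_ge0 ltrBlDr; have := floor_itv (x i 0).
by rewrite intrD addrC.
Qed.

Lemma frac_vec_Zd x : Zd (x - frac_vec x).
Proof. by move=> i; rewrite !mxE opprB addrC subrK intr_int. Qed.

Lemma unit_cube_uniq x y : (forall i, 0 <= x i 0 < 1) ->
  (forall i, 0 <= y i 0 < 1) -> Zd (x - y) -> x = y.
Proof.
move=> x01 y01 xyZ; apply/colP => i; apply/eqP; rewrite -subr_eq0.
have := xyZ i; rewrite !mxE => /intrP[m Em]; rewrite Em.
have /andP[x0 x1] := x01 i; have /andP[y0 y1] := y01 i.
have : -1 < m%:~R :> R by rewrite -Em; lra.
have : m%:~R < 1 :> R by rewrite -Em; lra.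
rewrite -[1 in X in X -> _]/(1%:~R) -[-1]/((-1)%:~R) !ltr_int.
by case: m {Em} => [[|]|].
Qed.

Lemma SAT_frac_vec x : Zd ((Defs.realmx R A)^T *m x) -> SAT A (frac_vec x).
Proof.
move=> xZ; split; first exact: frac_vec_bounds.
rewrite -[frac_vec x](subKr x) mulmxBr; apply: ZdB => //.
exact/Zd_mulAT/frac_vec_Zd.
Qed.

(** [S(A^T)] represents the quotient of the lattice of all [x] with [A^T x]
    integral by [Z^d]; translation by an element [w] of that lattice permutes
    the classes, and the inverse is the translation by [- w]. *)
Lemma SAT_translate_bij w : Zd ((Defs.realmx R A)^T *m w) ->
  set_bij (SAT A) (SAT A) (fun s => frac_vec (s + w)).
Proof.
move=> wZ; split.
- move=> s [_ sZ]; apply: SAT_frac_vec; rewrite mulmxDr; exact: ZdD.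
- move=> s t /set_mem[s01 _] /set_mem[t01 _] st; apply: unit_cube_uniq => //.
  have -> : s - t = (s + w - frac_vec (s + w)) - (t + w - frac_vec (t + w)).
    by rewrite st opprB addrA subrK opprD addrACA subrr addr0.
  by apply: ZdB; exact: frac_vec_Zd.
- move=> t [t01 tZ]; exists (frac_vec (t - w)).
    by apply: SAT_frac_vec; rewrite mulmxBr; exact: ZdB.
  apply: unit_cube_uniq => //; first exact: frac_vec_bounds.
  set u := frac_vec (t - w); set a := frac_vec (u + w).
  have -> : a - t = - ((u + w) - a) - ((t - w) - u).
    by apply/colP => i; rewrite !mxE; ring.
  by apply: ZdB; [apply: ZdN|]; exact: frac_vec_Zd.
Qed.

(** The translation of the argument by [B (2 pi k)] is absorbed by the
    permutation [s |-> frac_vec (s + B k)] of [S(A^T)], since [G] does not see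
    the integral part. *)
Lemma prod_SAT_periodic (Q : 'M[R]_d) x k : Zd k ->
  \big[*%R/1]_(s \in SAT A) G Q (invT R A *m (x + (2 * pi) *: k) + (2 * pi) *: s) =
  \big[*%R/1]_(s \in SAT A) G Q (invT R A *m x + (2 * pi) *: s).
Proof.
move=> kZ; pose w := invT R A *m k.
have wZ : Zd ((Defs.realmx R A)^T *m w) by rewrite mulAT_invT.
rewrite [RHS](@reindex_fsbig _ _ _ _ _ _ _ _ _ (SAT_translate_bij w wZ)).
apply: eq_fsbigr => s _.
rewrite -[RHS](G_periodic Q _ _ (frac_vec_Zd (s + w))).
congr (G Q _); rewrite mulmxDr -scalemxAr -/w; set a := frac_vec _.
by apply/colP => i; rewrite !mxE; ring.
Qed.

(** The factor [G] supplies the term [s = 0] missing in [m0]; only the complete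
    product over [S(A^T)] has the periodicity of [prod_SAT_periodic]. *)
Lemma m0G_eq (Q : 'M[R]_d) x :
  m0 A Q x * G Q x =
  (\big[*%R/1]_(s \in SAT A `\ 0) (G Q ((2 * pi) *: s))^-1) *
  \big[*%R/1]_(s \in SAT A) G Q (x + (2 * pi) *: s).
Proof.
have fS := finite_SAT.
have fS' : finite_set (SAT A `\ (0 : 'cV[R]_d)) by exact: finite_setD.
rewrite [X in _ = _ * X](fsbigD1 0)//; last exact: SAT0.
rewrite /= scaler0 addr0 mulrCA mulrC; congr (_ * _).
by rewrite /m0 !fsbig_finite//= -big_split/=; apply: eq_bigr => s _; rewrite mulrC.
Qed.

Lemma m0_0 (Q : 'M[R]_d) : posdefmx Q -> m0 A Q 0 = 1.
Proof.
move=> Qpos; rewrite /m0 fsbig1// => s [[s01 _] s0].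
rewrite add0r divff// G_eq0//; apply/negP => /set_mem[k kZ ks].
apply: s0; apply: unit_cube_uniq => // [i|]; first by rewrite mxE lexx ltr01.
have pi2 : 2 * pi != 0 :> R by rewrite mulf_neq0// gt_eqF// pi_gt0.
by rewrite subr0 -(scalerI pi2 ks).
Qed.

Lemma bounded_lipschitz_m0 (Q : 'M[R]_d) :
  bounded_lipschitz (fun x => m0 A Q (invT R A *m x)).
Proof.
have fS' : finite_set (SAT A `\ (0 : 'cV[R]_d)) by exact/finite_setD/finite_SAT.
rewrite /m0; under eq_fun do rewrite fsbig_finite//=.
apply: bounded_lipschitz_prod => s.
apply: bounded_lipschitzM; last exact: bounded_lipschitz_cst.
exact/bounded_lipschitz_affine/bounded_lipschitz_G.
Qed.

End DualLattice.

(** * The determinant of a dilation *)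

Section Dilation.
Context {R : realType} {d : nat} (A : 'M[int]_d).
Hypotheses (d_gt0 : (0 < d)%N) (Adil : isotropic_dilation R A).

(** In a diagonalization over the complex numbers, the diagonal entries are
    eigenvalues, of modulus greater than 1, and the determinant is their
    product, which is nonempty as [0 < d]. Comparing moduli of the images of the
    integer [det A] transfers the bound to the reals. *)
Lemma absdet_gt1 : 1 < absdet R A.
Proof.
case: Adil => eig_gt1 [P Pu /diagonalizable_forPex[D /(simmxP Pu) PA]] _.
have D_gt1 i : 1 < `|D 0 i|.
  apply: eig_gt1; apply/eigenvalueP; exists (row i P).
    by rewrite -row_mul PA row_mul row_diag_mx -scalemxAl -rowE.
  apply/eqP => Pi0; have := row_free_unit P; rewrite Pu => /row_freeP[B PB].
  have := congr1 (fun N => N *m B) Pi0; rewrite mul0mx -row_mul PB.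
  by move/matrixP/(_ 0 i); rewrite !mxE eqxx => /eqP; rewrite oner_eq0.
have detD : \det (map_mx intr A : 'M[R[i]]_d) = \prod_i D 0 i.
  apply: (mulfI (_ : \det P != 0)); first by rewrite -unitfE -unitmxE.
  by rewrite -det_mulmx PA det_mulmx det_diag mulrC.
have prod_gt1 : 1 < `|\prod_i D 0 i|.
  rewrite normr_prod (bigD1 (Ordinal d_gt0))//=.
  apply: lt_le_trans (D_gt1 (Ordinal d_gt0)) _.
  rewrite ler_peMr//; elim/big_ind : _ => // [x y x1 y1|i _].
    by rewrite mulr_ege1.
  exact: ltW.
move: prod_gt1; rewrite -detD /absdet /Defs.realmx !det_map_mx -!intr_norm.
by rewrite -[X in X < _ -> _]/(1%:~R) -[X in _ -> X < _]/(1%:~R) !ltr_int.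
Qed.

Lemma dilation_unit : Defs.realmx R A \in unitmx.
Proof.
rewrite unitmxE unitfE -normr_gt0; apply: lt_trans absdet_gt1; exact: ltr01.
Qed.

End Dilation.

(** * Behaviour of mu at the origin and continuity *)

Section Mu.
Context {R : realType} {d : nat} (A : 'M[int]_d) (Q : 'M[R]_d).
Hypotheses (d_gt0 : (0 < d)%N) (Adil : isotropic_dilation R A)
  (QA : factorization A Q).
Implicit Types x y k : 'cV[R]_d.

Let B := invT R A.
Let Qpos : posdefmx Q := QA.1.
Let Aunit := dilation_unit A d_gt0 Adil.
Let rho : R := absdet R A `^ (- d%:R^-1).

Lemma rho_gt0 : 0 < rho.
Proof. by rewrite powR_gt0// (lt_trans ltr01)// absdet_gt1. Qed.

Lemma rho_lt1 : rho < 1.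
Proof.
have q1 := absdet_gt1 A d_gt0 Adil.
rewrite /rho /powR gt_eqF ?(lt_trans ltr01)// expR_lt1.
by rewrite mulNr oppr_lt0 mulr_gt0 ?ln_gt0// invr_gt0 ltr0n.
Qed.

Lemma powR_rho_sqr : absdet R A `^ (2 / d%:R) * rho ^+ 2 = 1.
Proof.
have q0 : 0 < absdet R A by rewrite (lt_trans ltr01)// absdet_gt1.
rewrite /rho /powR gt_eqF// expr2 -!expRD (_ : _ + _ = 0) ?expR0//.
ring.
Qed.

(** [Q B = rho U Q], and [U] preserves the Euclidean norm. *)
Lemma sqnorm_invT x : sqnorm (Q *m (B *m x)) = rho ^+ 2 * sqnorm (Q *m x).
Proof.
have [U Uorth BE] := QA.2.
rewrite /B BE -/rho -scalemxAl -scalemxAr sqnormZ; congr (_ * _).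
rewrite !mulmxA mulmxV ?posdefmx_unit// mul1mx -mulmxA.
exact: sqnorm_orthogonal.
Qed.

Lemma sqnorm_invTX j x :
  sqnorm (Q *m (B ^+ j *m x)) = rho ^+ (2 * j) * sqnorm (Q *m x).
Proof.
elim: j => [|j IH]; first by rewrite muln0 !expr0 mul1mx mul1r.
by rewrite exprS -mulmxE -mulmxA sqnorm_invT IH mulrA -exprD mulnS.
Qed.

(** [N (B^j x) = rho^(2 j) N x], and [N] is comparable with [|x|^2]; the constant
    is the square root of the ratio of the two comparison constants. *)
Lemma invTX_norm_le : exists2 K, 0 <= K &
  forall j x, `|B ^+ j *m x| <= K * rho ^+ j * `|x|.
Proof.
have [c c0 lower] := unitmx_sqnorm_lower Q (posdefmx_unit Q Qpos).
have [L L0 QL] := mulmx_norm_bound Q.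
have dL0 : 0 <= d%:R * L ^+ 2 / c by rewrite divr_ge0 ?(ltW c0)// mulr_ge0// sqr_ge0.
have rho0 := ltW rho_gt0.
exists (Num.sqrt (d%:R * L ^+ 2 / c)) => [|j x]; first exact: sqrtr_ge0.
have rhs0 : 0 <= Num.sqrt (d%:R * L ^+ 2 / c) * rho ^+ j * `|x|.
  by rewrite !mulr_ge0 ?sqrtr_ge0// exprn_ge0.
rewrite -(@ler_pXn2r _ 2)// ?nnegrE// !exprMn sqr_sqrtr// -exprM (mulnC j).
rewrite -(ler_pM2l c0) (le_trans (lower _))// sqnorm_invTX.
have -> : c * (d%:R * L ^+ 2 / c * rho ^+ (2 * j) * `|x| ^+ 2) =
    rho ^+ (2 * j) * (d%:R * (L * `|x|) ^+ 2).
  by have c_neq0 : c != 0 by [rewrite gt_eqF|]; field.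
rewrite ler_wpM2l ?exprn_ge0// (le_trans (sqnorm_le_norm _))// ler_wpM2l//.
by rewrite lerXn2r ?nnegrE ?mulr_ge0.
Qed.

Lemma mu_formula_periodic x k : Zd k ->
  mu_formula A Q (x + (2 * pi) *: k) = mu_formula A Q x.
Proof.
move=> kZ; rewrite /mu_formula G_periodic// -!(mulrA (_ `^ _)) !m0G_eq//.
by rewrite prod_SAT_periodic.
Qed.

(** [mu_formula] is the product of [m0 (B x) = 1 + O(|x|)] and of
    [q^(2/d) G (B x) / G x]. In the latter, the numerator minus the denominator is
    [O(|x|^4)], the quadratic parts being both [N x], while [G x] is at least
    [c / 2 |x|^2] for small [x]. *)
Lemma mu_formula_near : exists C r, [/\ 0 <= C, 0 < r &
  forall x, x != 0 -> `|x| <= r ->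
    0 < G Q x /\ `|mu_formula A Q x - 1| <= C * `|x|].
Proof.
have [C C0 GC] := G_sqnorm_dist Q Qpos.
have [c c0 lower] := unitmx_sqnorm_lower Q (posdefmx_unit Q Qpos).
have [L L0 BL] := mulmx_norm_bound B.
have [D [D0 _ mD]] := bounded_lipschitz_m0 A Aunit Q.
pose q2 := absdet R A `^ (2 / d%:R).
have q20 : 0 <= q2 by exact: powR_ge0.
pose E := q2 * (C * L ^+ 4) + C.
have E0 : 0 <= E by rewrite addr_ge0// mulr_ge0// mulr_ge0// exprn_ge0.
pose F := 2 * E / c; have F0 : 0 <= F by rewrite divr_ge0 ?(ltW c0)// mulr_ge0.
(* For [|x| <= r] one has [C |x|^2 <= c / 2], so that the quartic error takes away
   at most half of the lower bound [c |x|^2] of [N x]. *)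
pose r := Num.min 1 (c / (2 * (C + 1))).
have C1 : 0 < C + 1 by rewrite ltr_wpDl.
exists (D * (F + 1) + F), r; split.
- by rewrite addr_ge0// mulr_ge0// addr_ge0.
- by rewrite lt_min ltr01 divr_gt0// mulr_gt0.
move=> x x0; rewrite le_min => /andP[x1 xr].
have nx0 : 0 < `|x| by rewrite normr_gt0.
have x2 : 0 < `|x| ^+ 2 by rewrite exprn_gt0.
have x21 : `|x| ^+ 2 <= `|x| by rewrite expr2 ler_piMr.
have Gx : c / 2 * `|x| ^+ 2 <= G Q x.
  have Cx : C * `|x| ^+ 2 <= c / 2.
    have : (C + 1) * `|x| <= c / 2.
      rewrite mulrC -ler_pdivlMr//; apply: le_trans xr _.
      by rewrite invfM mulrA.
    have : C * `|x| ^+ 2 <= C * `|x| by rewrite ler_wpM2l.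
    lra.
  have := GC x; rewrite ler_distl => /andP[h _]; apply: le_trans h.
  rewrite lerBrDr (le_trans _ (lower x))// (exprD _ 2 2) mulrA.
  have : C * `|x| ^+ 2 * `|x| ^+ 2 <= c / 2 * `|x| ^+ 2 by rewrite ler_wpM2r// ltW.
  lra.
have G0 : 0 < G Q x by apply: lt_le_trans Gx; rewrite mulr_gt0// divr_gt0.
split=> //.
pose ratio := q2 * G Q (B *m x) / G Q x.
have ratio_near : `|ratio - 1| <= F * `|x|.
  have -> : ratio - 1 = (q2 * G Q (B *m x) - G Q x) / G Q x.
    by rewrite mulrBl divff// gt_eqF.
  rewrite normrM normfV (ger0_norm (ltW G0)) ler_pdivrMr//.
  have num : `|q2 * G Q (B *m x) - G Q x| <= E * `|x| ^+ 4.
    have -> : q2 * G Q (B *m x) - G Q x =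
        q2 * (G Q (B *m x) - sqnorm (Q *m (B *m x))) - (G Q x - sqnorm (Q *m x)).
      rewrite mulrBr sqnorm_invT mulrA powR_rho_sqr mul1r opprB.
      by rewrite addrA subrK.
    rewrite (le_trans (ler_normB _ _))// [leRHS]mulrDl lerD//.
    rewrite normrM ger0_norm// -mulrA ler_wpM2l// (le_trans (GC _))// -mulrA.
    rewrite ler_wpM2l// -exprMn lerXn2r ?nnegrE ?mulr_ge0//.
  apply: (le_trans num).
  have h : F * `|x| * (c / 2 * `|x| ^+ 2) <= F * `|x| * G Q x.
    by rewrite ler_wpM2l// mulr_ge0.
  apply: le_trans h.
  have -> : F * `|x| * (c / 2 * `|x| ^+ 2) = E * (`|x| * `|x| ^+ 2).
    by rewrite /F; have c_neq0 : c != 0 by [rewrite gt_eqF|]; field.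
  rewrite ler_wpM2l// -exprS exprSr ler_piMr// exprn_ge0//.
have m0_near : `|m0 A Q (B *m x) - 1| <= D * `|x|.
  by have := mD x 0; rewrite mulmx0 m0_0// subr0.
have -> : mu_formula A Q x = m0 A Q (B *m x) * ratio.
  by rewrite /mu_formula -/B /ratio /q2; ring.
have -> : m0 A Q (B *m x) * ratio - 1 =
  (m0 A Q (B *m x) - 1) * ratio + (ratio - 1) by ring.
rewrite (le_trans (ler_normD _ _))// [leRHS]mulrDl lerD//.
rewrite normrM mulrAC ler_pM//.
have -> : ratio = (ratio - 1) + 1 by ring.
rewrite (le_trans (ler_normD _ _))// normr1 lerD2r (le_trans ratio_near)//.
by rewrite ler_piMr.
Qed.

Lemma dnbhs_cV_proper x : ProperFilter x^'.
Proof.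
apply: Build_ProperFilter_ex => P; rewrite /dnbhs /within/=.
move=> /nbhs_ballP[e /= e0 eP].
exists (x + const_mx (e / 2)); apply: eP.
  rewrite -ball_normE/= opprD addNKr normrN.
  apply: (@le_lt_trans _ _ (e / 2)).
    by apply: cV_norm_le => [|i]; rewrite ?mxE ?ger0_norm// ltW// divr_gt0.
  by rewrite ltr_pdivrMr// ltr_pMr// ltr1n.
apply/eqP => /(congr1 (fun y => y - x)); rewrite addrAC subrr add0r.
move/matrixP/(_ (Ordinal d_gt0) 0); rewrite !mxE => /eqP.
by rewrite gt_eqF// divr_gt0.
Qed.

(** The limit defining [mu] on [2 pi Z^d] exists and equals 1: by periodicity it
    may be taken at the origin, where [mu_formula_near] applies. Stating the
    dichotomy by the zeros of [G] makes periodicity and continuity direct. *)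
Lemma muE x : mu A Q x = if G Q x == 0 then 1 else mu_formula A Q x.
Proof.
rewrite /mu G_eq0//; case: ifPn => // /set_mem[k kZ <-].
have [C [r [C0 r0 near]]] := mu_formula_near.
pose x0 : 'cV[R]_d := (2 * pi) *: k; rewrite -/x0.
have x0_proper := dnbhs_cV_proper x0.
apply: cvg_lim => //; apply/cvgrPdist_lt => e e0.
have C1 : 0 < C + 1 by rewrite ltr_wpDl.
suff : \forall y \near x0, y != x0 -> `|1 - mu_formula A Q y| < e by [].
near=> y.
have yr : `|x0 - y| < Num.min r (e / (C + 1)).
  by near: y; apply: (@near_dist_lt R 'cV[R]_d); rewrite lt_min r0 divr_gt0.
move=> yx0; have -> : y = (y - x0) + x0 by rewrite subrK.
rewrite mu_formula_periodic// distrC.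
move: yr; rewrite (distrC x0) lt_min => /andP[yr ye].
have [|_] := near (y - x0) _ (ltW yr); first by rewrite subr_eq0.
move=> /le_lt_trans; apply; apply: (@le_lt_trans _ _ ((C + 1) * `|y - x0|)).
  by rewrite ler_wpM2r// lerDl.
by rewrite mulrC -ltr_pdivlMr.
Unshelve. all: by end_near. Qed.

Lemma mu_periodic x k : Zd k -> mu A Q (x + (2 * pi) *: k) = mu A Q x.
Proof. by move=> kZ; rewrite !muE G_periodic// mu_formula_periodic. Qed.

Lemma mu_near : exists C r, [/\ 0 <= C, 0 < r &
  forall x, `|x| <= r -> `|mu A Q x - 1| <= C * `|x|].
Proof.
have [C [r [C0 r0 near]]] := mu_formula_near; exists C, r; split=> // x xr.
have [->|x0] := eqVneq x 0; first by rewrite muE G0 eqxx subrr normr0 mulr_ge0.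
by have [Gx h] := near x x0 xr; rewrite muE gt_eqF.
Qed.

(** At a zero of [G], periodicity reduces to the estimate at the origin;
    elsewhere [mu] is locally a quotient of continuous functions. *)
Lemma mu_continuous : continuous (mu A Q).
Proof.
move=> x; have [Gx|Gx] := eqVneq (G Q x) 0.
  have [C [r [C0 r0 near]]] := mu_near.
  have /set_mem[k kZ kx] : x \in [set (2 * pi) *: k | k in @Zd R d].
    by rewrite -(G_eq0 Q Qpos) Gx.
  apply: continuous_at_dist => e e0; have C1 : 0 < C + 1 by rewrite ltr_wpDl.
  near=> y; rewrite [mu A Q x]muE Gx eqxx distrC.
  have yr : `|x - y| < Num.min r (e / (C + 1)).
    by near: y; apply: (@near_dist_lt R 'cV[R]_d); rewrite lt_min r0 divr_gt0.
  move: yr; rewrite (distrC x) lt_min => /andP[yr ye].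
  have -> : y = (y - x) + (2 * pi) *: k by rewrite kx subrK.
  rewrite mu_periodic//; apply: le_lt_trans (near _ (ltW yr)) _.
  apply: (@le_lt_trans _ _ ((C + 1) * `|y - x|)); first by rewrite ler_wpM2r// lerDl.
  by rewrite mulrC -ltr_pdivlMr.
have num_bl : bounded_lipschitz (fun y : 'cV[R]_d =>
    absdet R A `^ (2 / d%:R) * m0 A Q (B *m y) * G Q (B *m y)).
  apply: bounded_lipschitzM.
    apply: bounded_lipschitzM; first exact: bounded_lipschitz_cst.
    exact: bounded_lipschitz_m0.
  have := bounded_lipschitz_affine _ B 0 (bounded_lipschitz_G Q).
  by under [X in bounded_lipschitz X -> _]eq_fun do rewrite addr0.
have := bounded_lipschitz_div_continuous num_bl (bounded_lipschitz_G Q) Gx.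
apply: near_eq_continuous.
apply: filterS (bounded_lipschitz_near_neq0 (bounded_lipschitz_G Q) Gx) => y Gy.
by rewrite muE (negbTE Gy).
Unshelve. all: by end_near. Qed.

End Mu.

(** * The factors of the infinite product *)

Section MuFactors.
Context {R : realType} {d : nat} (A : 'M[int]_d) (Q : 'M[R]_d).
Hypotheses (d_gt0 : (0 < d)%N) (Adil : isotropic_dilation R A)
  (QA : factorization A Q).

Lemma mu_factor_continuous j : continuous (mu_factor A Q j).
Proof.
have [L L0 BL] := mulmx_norm_bound (invT R A ^+ j).
have lin : continuous (fun x : 'cV[R]_d => invT R A ^+ j *m x).
  by apply: lipschitz_continuous L0 _ => x y; rewrite -mulmxBr.
move=> x; rewrite /mu_factor.
exact: continuous_comp (lin x) (mu_continuous A Q d_gt0 Adil QA _).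
Qed.

(** For [|x| <= r] the point [B^j x] has norm at most [K r rho^j]; from the index
    [m] on it lies in the ball where [|mu - 1|] is controlled linearly. *)
Lemma mu_factor_summable (r : R) : 0 <= r -> exists (m : nat) (b : nat -> R),
  [/\ forall j, 0 <= b j, cvgn (series b) &
    forall j x, (m <= j)%N -> `|x| <= r -> `|mu_factor A Q j x - 1| <= b j].
Proof.
move=> r0.
have [C [s [C0 s0 near]]] := mu_near A Q d_gt0 Adil QA.
have [K K0 orbit] := invTX_norm_le A Q d_gt0 Adil QA.
set rho : R := absdet R A `^ (- d%:R^-1) in orbit.
have rho0 : 0 < rho := rho_gt0 A d_gt0 Adil.
have rho1 : rho < 1 := rho_lt1 A d_gt0 Adil.
have Kr0 : 0 <= K * r by exact: mulr_ge0.
have [m _ rho_m] : \forall n \near \oo, rho ^+ n < s / (K * r + 1).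
  apply: (cvgr_lt 0); first by apply: cvg_expr; rewrite ger0_norm// ltW.
  by rewrite divr_gt0// ltr_wpDl.
exists m, (geometric (C * (K * r)) rho); split=> [j||j x mj xr].
- by rewrite /= mulr_ge0 ?mulr_ge0// exprn_ge0// ltW.
- by apply: is_cvg_geometric_series; rewrite ger0_norm// ltW.
have Bx : `|invT R A ^+ j *m x| <= K * r * rho ^+ j.
  apply: (le_trans (orbit j x)); rewrite mulrAC ler_wpM2r ?exprn_ge0 ?(ltW rho0)//.
  by rewrite ler_wpM2l.
rewrite /mu_factor /= -mulrA; apply: le_trans (near _ _) _; last first.
  by rewrite ler_wpM2l.
apply: (le_trans Bx); apply: (@le_trans _ _ ((K * r + 1) * rho ^+ j)).
  by rewrite ler_wpM2r ?lerDl// exprn_ge0// ltW.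
by rewrite mulrC -ler_pdivlMr ?ltr_wpDl// ltW// rho_m.
Qed.

End MuFactors.

Theorem theorem3p6 (R : realType) (d : nat) (A : 'M[int]_d) (Q : 'M[R]_d)
    (hd : (0 < d)%N) (hA : isotropic_dilation R A) (hQ : factorization A Q) :
  (forall K : set 'cV[R]_d, compact K -> prod_abs_unif_cvg K (mu_factor A Q)) /\
  continuous (M A Q).
Proof.
split=> [K Kcomp|x0].
- have bounded_on (f : 'cV[R]_d -> R) : continuous f ->
      exists B : R, forall x, K x -> `|f x| <= B.
    move=> fcont.
    have /compact_bounded[B [_ HB]] : compact (f @` K).
      by apply: continuous_compact => //; exact: continuous_subspaceT.
    by exists (B + 1) => x Kx; apply: HB; [rewrite ltrDl|exists x].
  have [r Kr] := bounded_on (fun x => `|x|) (@norm_continuous _ _).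
  have [m [b [b0 cb fb]]] := mu_factor_summable A Q hd hA hQ `|r| (normr_ge0 r).
  have factor_b j x : (m <= j)%N -> K x -> `|mu_factor A Q j x - 1| <= b j.
    move=> mj Kx; apply: fb => //.
    by have := Kr x Kx; rewrite normr_id => /le_trans; apply; exact: ler_norm.
  have factor_bnd j := bounded_on _ (mu_factor_continuous A Q hd hA hQ j).
  split; apply: (@prod_unif_cvg_summable _ _ K _ b m) => //.
    by move=> j x mj Kx; rewrite addrAC subrr add0r normr_id factor_b.
  move=> j; have [B HB] := factor_bnd j; exists (1 + (B + 1)) => x Kx.
  rewrite (le_trans (ler_normD _ _))// normr1 lerD2l normr_id.
  by rewrite (le_trans (ler_normB _ _))// normr1 lerD2r HB.
- have r0 : 0 <= `|x0| + 1 by rewrite addr_ge0.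
  have [m [b [b0 cb fb]]] := mu_factor_summable A Q hd hA hQ _ r0.
  apply: (infprod_continuous_at (mu_factor A Q) b m) => // [|j]; last first.
    exact: mu_factor_continuous.
  have := near_dist_lt x0 1 ltr01; apply: filterS => x xx0 j mj; apply: fb => //.
  have -> : x = x0 - (x0 - x) by rewrite subKr.
  by rewrite (le_trans (ler_normB _ _))// lerD2l ltW.
Qed.
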